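(* Let $T$ be a finite tree with diameter at least $3$ and maximum degree $\Delta \ge 3$, or an infinite tree with finite maximum degree $\Delta \ge 3$, and let $\Delta_2 = \max_{uv \in E(T)}(d(u)+d(v))$. Then, for any integer $h \ge 1$, $$\max\{\Delta_2,\ 2h + \Delta - 1\} \le \sigma_{h,1,1}(T) \le \sigma^*_{h,1,1}(T) \le \max\{h+2\Delta-1,\ 2h+\Delta-1\}.$$ In particular, if $h \le \Delta$ and $T$ contains $T_{\Delta-1,2}$ as a subtree, then $$h+2\Delta-2 \le \sigma_{h,1,1}(T) \le \sigma^*_{h,1,1}(T) \le h+2\Delta-1;$$ if $h \le \Delta$ and $T$ contains $\hat{T}_{\Delta-1,2}$ as a subtree, then $$\sigma_{h,1,1}(T) = \sigma^*_{h,1,1}(T) = h+2\Delta-1.$$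
   Context: Infinite graphs have countably infinitely many vertices. $d(u)$ is the degree of $u$, $N(u)$ its neighbourhood, and $d(u,v)$ the distance between $u$ and $v$. For a positive integer $\ell$, $|x|_\ell=\min\{|x|,\ell-|x|\}$. A $C(h_1,h_2,h_3)$-labelling of a graph $G$ with span $\ell$ is a mapping $f: V(G)\to\{0,1,\ldots,\ell-1\}$ such that for $i=1,2,3$ and any $u,v\in V(G)$ with $d(u,v)=i$ we have $|f(u)-f(v)|_\ell\ge h_i$. $\sigma_{h_1,h_2,h_3}(G)$ is the minimum integer $\ell$ such that $G$ admits a $C(h_1,h_2,h_3)$-labelling with span $\ell$. An interval modulo $\ell$ is a set of the form $\{a \bmod \ell, (a+1) \bmod \ell, \ldots, b \bmod \ell\}$ (going cyclically from $a$ to $b$). A $C(h_1,h_2,h_3)$-labelling $f$ with span $\ell$ is elegant if for every vertex $u$ there is an interval $I_u$ modulo $\ell$ such that $f(N(u))\subseteq I_u$, and for every edge $uv$, $I_u\cap I_v=\emptyset$. $\sigma^*_{h_1,h_2,h_3}(G)$ is the minimum $\ell$ such that $G$ admits an elegant $C(h_1,h_2,h_3)$-labelling with span $\ell$ ($\infty$ if none exists). For $m,k\ge2$: $T_{m,k}$ is the complete $m$-ary tree of height $k$, i.e. the rooted tree in which every non-leaf vertex has exactly $m$ children and all leaves are at level (distance from the root) $k$; $\hat{T}_{m,k}$ is the finite subtree of the infinite $(m+1)$-regular tree induced by all vertices at distance at most $k$ from a fixed vertex. *)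

(* Defs.v *)
From mathcomp Require Import all_boot all_order all_algebra.
From mathcomp Require Import finmap.
From mathcomp Require Import boolp classical_sets functions cardinality.

Set Implicit Arguments.
Unset Strict Implicit.
Unset Printing Implicit Defensive.

Local Open Scope nat_scope.
Local Open Scope card_scope.
Local Open Scope classical_set_scope.

Definition is_min (A : set nat) (n : nat) : Prop :=
  A n /\ forall k, A k -> n <= k.

Definition is_max (A : set nat) (n : nat) : Prop :=
  A n /\ forall k, A k -> k <= n.

Record sgraph (V : Type) := SGraph {
  adj :> rel V;
  adj_sym : symmetric adj;
  adj_irrefl : irreflexive adj
}.

Definition nbrs (V : Type) (G : sgraph V) (u : V) : set V :=
  [set v | adj G u v].

(* [fset_set] sends infinite sets to the empty one, so [deg] is meaningful only
   at vertices with finitely many neighbours. *)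
Definition deg (V : choiceType) (G : sgraph V) (u : V) : nat :=
  #|` fset_set (nbrs G u)|.

Definition max_degree (V : choiceType) (G : sgraph V) (D : nat) : Prop :=
  (forall u, finite_set (nbrs G u)) /\ is_max [set deg G u | u in [set: V]] D.

Definition max_edge_degree (V : choiceType) (G : sgraph V) (D2 : nat) : Prop :=
  is_max [set n | exists u v, adj G u v /\ n = deg G u + deg G v] D2.

Definition walk (V : Type) (G : sgraph V) (u v : V) (n : nat) : Prop :=
  exists p : seq V, [/\ path (adj G) u p, last u p = v & size p = n].

(* [dist G u v n] reads d(u, v) = n; it fails for every n when u and v lie in
   different components. *)
Definition dist (V : Type) (G : sgraph V) (u v : V) (n : nat) : Prop :=
  is_min [set k | walk G u v k] n.

Definition diameter (V : Type) (G : sgraph V) (D : nat) : Prop :=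
  is_max [set n | exists u v, dist G u v n] D.

Definition connected_graph (V : Type) (G : sgraph V) : Prop :=
  inhabited V /\ forall u v, exists n, walk G u v n.

Definition acyclic (V : eqType) (G : sgraph V) : Prop :=
  forall c : seq V, ucycle (adj G) c -> size c < 3.

Definition is_tree (V : eqType) (G : sgraph V) : Prop :=
  connected_graph G /\ acyclic G.

(* Possibly non-induced; between trees, every such copy is induced. *)
Definition contains (V W : Type) (G : sgraph V) (H : sgraph W) : Prop :=
  exists2 f : W -> V, injective f & forall x y, adj H x y -> adj G (f x) (f y).

Definition children (V : Type) (G : sgraph V) (r u : V) : set V :=
  [set v | adj G u v /\ exists n, dist G r u n /\ dist G r v n.+1].

(* T_{m,k}, up to isomorphism; a leaf of a rooted tree is a vertex without
   children. *)
Definition is_complete_ary (m k : nat) (W : finType) (H : sgraph W) : Prop :=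
  is_tree H /\
  exists r : W,
    (forall u, children H r u !=set0 -> children H r u #= `I_m) /\
    (forall u, children H r u = set0 -> dist H r u k).

Definition ball (V : Type) (G : sgraph V) (c : V) (k : nat) : set V :=
  [set v | exists2 n, dist G c v n & n <= k].

Definition is_infinite_regular_tree (d : nat) (U : countType) (R : sgraph U) :
    Prop :=
  [/\ is_tree R, infinite_set [set: U] & forall u, nbrs R u #= `I_d].

(* \hat T_{m,k}, up to isomorphism. *)
Definition is_regular_ball (m k : nat) (W : finType) (H : sgraph W) : Prop :=
  exists (U : countType) (R : sgraph U) (c : U) (g : W -> U),
    [/\ is_infinite_regular_tree m.+1 R,
        injective g,
        range g = ball R c k
      & forall x y, adj H x y = adj R (g x) (g y)].

(* |x - y|_l *)
Definition cdist (l x y : nat) : nat := minn `|x - y| (l - `|x - y|).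

Definition labelling (h1 h2 h3 : nat) (V : Type) (G : sgraph V) (l : nat)
    (f : V -> nat) : Prop :=
  [/\ 0 < l,
      forall u, f u < l,
      forall u v, dist G u v 1 -> h1 <= cdist l (f u) (f v),
      forall u v, dist G u v 2 -> h2 <= cdist l (f u) (f v)
    & forall u v, dist G u v 3 -> h3 <= cdist l (f u) (f v)].

(* {a mod l, (a+1) mod l, ..., b mod l}; an interval wrapping around 0 has its
   right end b represented beyond l. *)
Definition interval_mod (l : nat) (I : set nat) : Prop :=
  exists a b, a <= b /\ I = [set i %% l | i in [set i | a <= i <= b]].

Definition elegant (V : Type) (G : sgraph V) (l : nat) (f : V -> nat) : Prop :=
  exists I : V -> set nat,
    [/\ forall u, interval_mod l (I u),
        forall u, f @` nbrs G u `<=` I u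
      & forall u v, adj G u v -> I u `&` I v = set0].

Definition is_sigma (h1 h2 h3 : nat) (V : Type) (G : sgraph V) (s : nat) :
    Prop :=
  is_min [set l | exists f, labelling h1 h2 h3 G l f] s.

(* The infinite value is represented by the absence of any such [s]. *)
Definition is_sigma_star (h1 h2 h3 : nat) (V : Type) (G : sgraph V) (s : nat) :
    Prop :=
  is_min [set l | exists f, labelling h1 h2 h3 G l f /\ elegant G l f] s.

(* Main.v *)
Require Import Defs.
From mathcomp Require Import all_boot all_order all_algebra.
From mathcomp Require Import finmap zify.
From mathcomp Require Import boolp classical_sets functions cardinality.

(** Why the bounds hold.  Since every separation is at least 1, two distinct
    vertices at distance at most 3 have different labels.

    Lower bounds come from counting labels.  All labels on the two
    neighbourhoods of an edge are distinct ([span_ge_edge_degree]).  The labels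
    on the neighbours of a vertex of degree Delta are distinct and miss the
    2h - 1 residues closer than h to its label ([span_ge_star]).  For the bounds
    in terms of subtrees, rotate the labels so that a vertex u gets 0, and let S
    be a set of neighbours of u of degree at least D.  Among S take the vertex v
    of least label.  The labels on N(v), the h integers ending at f(v), and the
    labels on the rest of S are pairwise different, so the span is at least
    h + (|S| - 1) + D ([span_ge_high_degree_nbrs]).  A copy of the complete
    (Delta - 1)-ary tree of height 2 provides D = Delta and |S| = Delta - 1; a
    copy of the ball of radius 2 provides D = |S| = Delta.

    For the upper bound let l = max (h + 2 Delta - 1, 2h + Delta - 1).  Root the
    tree and give each vertex u a window of Delta consecutive residues, all at
    circular distance at least h from the label of u, from which the neighbours
    of u take distinct labels.  This propagates from parent to child.  If the
    window of u starts at s and the child v gets the label s + b, let the window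
    of v start at s + m with m = max (Delta, b + h).  The choice of l is exactly
    what makes the new window disjoint from the old one, at distance h from
    s + b, and such that it still contains the label of u ([exists_layout]).
    Disjointness of adjacent windows is elegance, and it also separates vertices
    at distance 3 ([layout_labelling]).  The construction is a recursion on the
    level, so infinite trees need no limiting argument. *)

Set Implicit Arguments.
Unset Strict Implicit.
Unset Printing Implicit Defensive.

Local Open Scope nat_scope.
Local Open Scope classical_set_scope.
Local Open Scope card_scope.

(** * Minima and circular distance *)

Lemma exists_is_min (A : set nat) (n : nat) : A n -> exists m, is_min A m.
Proof.
move=> An; have exA : exists k, `[< A k >] by exists n; apply/asboolP.
exists (ex_minn exA); case: ex_minnP => m /asboolP Am minA; split=> // k Ak.
exact/minA/asboolP.
Qed.

Lemma is_min_unique (A : set nat) (m n : nat) : is_min A m -> is_min A n -> m = n.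
Proof. by move=> [Am minm] [An minn]; apply/eqP; rewrite eqn_leq minm ?minn. Qed.

Lemma cdistC (l x y : nat) : cdist l x y = cdist l y x.
Proof. rewrite /cdist; lia. Qed.

Lemma cdist_gt0_neq (l x y : nat) : 0 < cdist l x y -> x <> y.
Proof. rewrite /cdist; lia. Qed.

Lemma cdist0n (l x : nat) : cdist l 0 x = minn x (l - x).
Proof. rewrite /cdist; lia. Qed.

Lemma cdist_gt0 (l x y : nat) : x < l -> y < l -> x <> y -> 0 < cdist l x y.
Proof. rewrite /cdist; lia. Qed.

(** The interface to modular arithmetic: residues are compared through a lift of
    their difference, so that wrapping around 0 never needs a case analysis. *)
Lemma cdist_mod_ge (l h k x : nat) :
  h <= k -> k + h <= l -> h <= cdist l (x %% l) ((x + k) %% l).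
Proof.
move=> hk khl; case: (posnP h) => [->//|h_gt0].
have l_gt0 : 0 < l by lia.
rewrite -modnDml; have := ltn_pmod x l_gt0; move: (x %% l) => y yl.
rewrite /cdist; case: (ltnP (y + k) l) => ykl; first by rewrite modn_small //; lia.
rewrite -(subnK ykl) modnDr modn_small; lia.
Qed.

Lemma cdist_shift (l t x y : nat) : x < l -> y < l ->
  cdist l ((x + t) %% l) ((y + t) %% l) = cdist l x y.
Proof.
move=> xl yl; have l_gt0 : 0 < l by lia.
rewrite -(modnDmr x) -(modnDmr y); have := ltn_pmod t l_gt0.
move: (t %% l) => {}t tl.
have shiftE z : z < l -> (z + t) %% l = if z + t < l then z + t else z + t - l.
  move=> zl; case: ltnP => ztl; first by rewrite modn_small.
  by rewrite -{1}(subnK ztl) modnDr modn_small //; lia.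
rewrite !shiftE //; rewrite /cdist; case: ltnP => ?; case: ltnP => ?; lia.
Qed.

(** * Distinct labels at short range *)

Lemma walk_neq_dist (V : eqType) (G : sgraph V) (x y : V) (n : nat) :
  x <> y -> walk G x y n -> exists k, [/\ 0 < k, k <= n & dist G x y k].
Proof.
move=> neq_xy wn; have [k dk] := exists_is_min wn.
exists k; split=> //; last exact: dk.2.
case: k dk => // -[[p [_ lastp /size0nil p0]] _]; case: neq_xy.
by rewrite -lastp p0.
Qed.

Lemma dist_adj (V : eqType) (G : sgraph V) (u v : V) : adj G u v -> dist G u v 1.
Proof.
move=> uv; have w1 : walk G u v 1 by exists [:: v]; rewrite /= uv.
have neq_uv : u <> v by move=> uvE; move: uv; rewrite uvE adj_irrefl.
have [k [k_gt0 k_le1 dk]] := walk_neq_dist neq_uv w1.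
by have -> : 1 = k by lia.
Qed.

(** With positive separations a walk of length at most 3 is enough to tell labels
    apart: whatever the exact distance is, it lies in {1, 2, 3}.  This spares
    any computation of distances in the tree. *)
Lemma labelling_neq (V : eqType) (G : sgraph V) (h1 h2 h3 l n : nat)
    (f : V -> nat) (x y : V) :
  0 < h1 -> 0 < h2 -> 0 < h3 -> labelling h1 h2 h3 G l f ->
  x <> y -> walk G x y n -> n <= 3 -> f x <> f y.
Proof.
move=> h1_gt0 h2_gt0 h3_gt0 [_ _ d1 d2 d3] neq_xy wn n_le3.
have [k [k_gt0 k_len dk]] := walk_neq_dist neq_xy wn.
apply: (@cdist_gt0_neq l); have : k <= 3 by lia.
case: k k_gt0 {k_len} dk => [|[|[|[|]]]] // _ dk _.
- exact: leq_trans (d1 _ _ dk).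
- exact: leq_trans (d2 _ _ dk).
- exact: leq_trans (d3 _ _ dk).
Qed.

Lemma labelling_adj (V : eqType) (G : sgraph V) (h1 h2 h3 l : nat)
    (f : V -> nat) (u v : V) :
  labelling h1 h2 h3 G l f -> adj G u v -> h1 <= cdist l (f u) (f v).
Proof. by move=> [_ _ d1 _ _] /dist_adj /d1. Qed.

Lemma labelling_shift (V : Type) (G : sgraph V) (h1 h2 h3 l t : nat)
    (f : V -> nat) :
  labelling h1 h2 h3 G l f ->
  labelling h1 h2 h3 G l (fun v => (f v + t) %% l).
Proof.
move=> [l_gt0 fl d1 d2 d3]; split=> // [u|u v|u v|u v]; first exact: ltn_pmod.
- by rewrite cdist_shift //; exact: d1.
- by rewrite cdist_shift //; exact: d2.
- by rewrite cdist_shift //; exact: d3.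
Qed.

Lemma labelling_normalize (V : Type) (G : sgraph V) (h1 h2 h3 l : nat)
    (f : V -> nat) (u : V) :
  labelling h1 h2 h3 G l f ->
  exists2 g, labelling h1 h2 h3 G l g & g u = 0.
Proof.
move=> fL; exists (fun v => (f v + (l - f u)) %% l); first exact: labelling_shift.
by have [_ fl _ _ _] := fL; rewrite subnKC ?modnn // ltnW.
Qed.

(** * Lower bounds on the span *)

Definition nbr_seq (V : choiceType) (G : sgraph V) (u : V) : seq V :=
  enum_fset (fset_set (nbrs G u)).

Lemma mem_nbr_seq (V : choiceType) (G : sgraph V) (u v : V) :
  finite_set (nbrs G u) -> (v \in nbr_seq G u) = adj G u v.
Proof.
move=> finu; have -> : (v \in nbr_seq G u) = (v \in fset_set (nbrs G u)) by [].
by rewrite in_fset_set //; apply/idP/idP => [/set_mem//|uv]; apply: mem_set.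
Qed.

Lemma size_nbr_seq (V : choiceType) (G : sgraph V) (u : V) :
  size (nbr_seq G u) = deg G u.
Proof. by []. Qed.

Lemma nbr_seq_uniq (V : choiceType) (G : sgraph V) (u : V) : uniq (nbr_seq G u).
Proof. exact: fset_uniq. Qed.

Lemma uniq_bounded_size (l : nat) (s : seq nat) :
  uniq s -> (forall x, x \in s -> x < l) -> size s <= l.
Proof.
move=> us sl; rewrite -[leqRHS](size_iota 0); apply: uniq_leq_size => // x /sl.
by rewrite mem_iota.
Qed.

Lemma triangle_free (V : eqType) (G : sgraph V) (u v x : V) :
  acyclic G -> adj G u v -> adj G u x -> adj G v x -> False.
Proof.
move=> acG uv ux vx; have /acG : ucycle (adj G) [:: u; v; x]; last by [].
have adj_neq y z : adj G y z -> y != z.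
  by move=> yz; apply/eqP => yzE; rewrite yzE adj_irrefl in yz.
by rewrite /ucycle /= uv vx adj_sym ux !inE /= !andbT negb_or !adj_neq.
Qed.

Lemma nbr_labels_inj (V : eqType) (G : sgraph V) (h l : nat) (f : V -> nat)
    (u : V) :
  0 < h -> labelling h 1 1 G l f ->
  forall x y, adj G u x -> adj G u y -> f x = f y -> x = y.
Proof.
move=> h_gt0 fL x y ux uy; apply: contra_eq => /eqP neq_xy; apply/eqP.
apply: (labelling_neq (n := 2) _ _ _ fL) => //.
by exists [:: u; y]; rewrite /= adj_sym ux uy.
Qed.

(** The walk from x to y through u and v has length 3; acyclicity only serves to
    exclude x = y, which would close a triangle. *)
Lemma edge_labels_neq (V : eqType) (G : sgraph V) (h l : nat) (f : V -> nat)
    (u v x y : V) :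
  acyclic G -> 0 < h -> labelling h 1 1 G l f -> adj G u v ->
  adj G u x -> adj G v y -> f x <> f y.
Proof.
move=> acG h_gt0 fL uv ux vy; apply: (labelling_neq (n := 3) _ _ _ fL) => //.
  move=> xyE; rewrite -xyE in vy; exact: triangle_free acG uv ux vy.
by exists [:: u; v; y]; rewrite /= adj_sym ux uv vy.
Qed.

Lemma span_ge_edge_degree (V : choiceType) (G : sgraph V) (h l : nat)
    (f : V -> nat) (u v : V) :
  (forall u, finite_set (nbrs G u)) -> acyclic G -> 0 < h ->
  labelling h 1 1 G l f -> adj G u v -> deg G u + deg G v <= l.
Proof.
move=> finG acG h_gt0 fL uv; have [_ fl _ _ _] := fL.
rewrite -!size_nbr_seq -(size_map f) -(size_map f (nbr_seq G v)) -size_cat.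
have uniq_nbr w : uniq (map f (nbr_seq G w)).
  rewrite map_inj_in_uniq ?nbr_seq_uniq // => x y; rewrite !mem_nbr_seq //.
  exact: (nbr_labels_inj h_gt0 fL).
apply: uniq_bounded_size => [|i]; last by rewrite mem_cat => /orP[] /mapP[x _ ->].
rewrite cat_uniq !uniq_nbr andbT; apply/hasPn => _ /mapP[y vy ->].
apply/mapP => -[x ux fyx]; rewrite !mem_nbr_seq // in ux vy.
exact: (edge_labels_neq acG h_gt0 fL uv ux vy) (esym fyx).
Qed.

(** After rotating f(u) to 0, the labels of N(u) avoid the h residues from 0 and
    the h - 1 residues below l. *)
Lemma span_ge_star (V : choiceType) (G : sgraph V) (h l : nat)
    (f : V -> nat) (u v : V) :
  (forall u, finite_set (nbrs G u)) -> 0 < h ->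
  labelling h 1 1 G l f -> adj G u v -> 2 * h + deg G u - 1 <= l.
Proof.
move=> finG h_gt0 /(labelling_normalize u)[{}f fL fu0] uv.
have [_ fl _ _ _] := fL.
have away x : adj G u x -> h <= f x /\ f x + h <= l.
  by move=> /(labelling_adj fL); rewrite fu0 cdist0n; have := fl x; lia.
have [hv vl] := away v uv.
suff: size (map f (nbr_seq G u) ++ iota 0 h ++ iota (l - h + 1) (h - 1)) <= l.
  rewrite !size_cat size_map size_nbr_seq !size_iota; lia.
apply: uniq_bounded_size => [|i]; last first.
  by rewrite !mem_cat !mem_iota => /or3P[/mapP[x _ ->]//||]; lia.
rewrite !cat_uniq !iota_uniq map_inj_in_uniq ?nbr_seq_uniq //=; last first.
  move=> x y; rewrite !mem_nbr_seq //.
  exact: (nbr_labels_inj h_gt0 fL).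
rewrite andbT; apply/andP; split; apply/hasPn => i.
  rewrite mem_cat !mem_iota => ir; apply/mapP => -[x]; rewrite mem_nbr_seq //.
  by move=> /away; lia.
rewrite !mem_iota; lia.
Qed.

(** Taking v of least label in S is what makes the count sharp: the labels of the
    other members of S then lie above f(v), so they are disjoint from the h
    residues ending at f(v), and N(v) avoids both groups. *)
Lemma span_ge_high_degree_nbrs (V : choiceType) (G : sgraph V) (h l D : nat)
    (f : V -> nat) (u : V) (S : seq V) :
  (forall u, finite_set (nbrs G u)) -> acyclic G -> 0 < h ->
  labelling h 1 1 G l f -> uniq S -> 0 < size S ->
  (forall v, v \in S -> adj G u v /\ D <= deg G v) ->
  h + (size S - 1) + D <= l.
Proof.
move=> finG acG h_gt0 /(labelling_normalize u)[{}f fL fu0] uS S_gt0 SP.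
have [_ fl _ _ _] := fL.
have [v vS minv] : exists2 v, v \in S & forall w, w \in S -> f v <= f w.
  have [i [[v vS <-] mini]] : exists i, is_min [set f v | v in [set` S]] i.
    case: S S_gt0 {uS SP} => // a S _; apply: (@exists_is_min _ (f a)).
    by exists a; rewrite //= inE eqxx.
  by exists v => // w wS; apply: mini; exists w.
have [uv Dv] := SP v vS.
have [hv vl] : h <= f v /\ f v + h <= l.
  by have := labelling_adj fL uv; rewrite fu0 cdist0n; have := fl v; lia.
suff: size (map f (nbr_seq G v) ++ iota (f v - h + 1) h ++ map f (rem v S)) <= l.
  rewrite !size_cat !size_map size_nbr_seq size_iota size_rem // -subn1 => le_l.
  by apply: leq_trans le_l; rewrite addnC leq_add2r.
have remP w : w \in rem v S -> [/\ w \in S, adj G u w & f v < f w].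
  rewrite mem_rem_uniq // !inE => /andP[/eqP neq_wv wS]; have [uw _] := SP w wS.
  split=> //; rewrite ltn_neqAle minv // andbT; apply/eqP => fvw; apply: neq_wv.
  exact/esym/(nbr_labels_inj h_gt0 fL uv uw).
apply: uniq_bounded_size => [|i]; last first.
  rewrite !mem_cat mem_iota => /or3P[/mapP[x _ ->]//||/mapP[x _ ->]//]; lia.
have uniq_nbr : uniq (map f (nbr_seq G v)).
  rewrite map_inj_in_uniq ?nbr_seq_uniq // => x y; rewrite !mem_nbr_seq //.
  exact: (nbr_labels_inj h_gt0 fL).
have uniq_rem : uniq (map f (rem v S)).
  rewrite map_inj_in_uniq ?rem_uniq // => x y /remP[_ ux _] /remP[_ uy _].
  exact: (nbr_labels_inj h_gt0 fL ux uy).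
rewrite !cat_uniq iota_uniq uniq_nbr uniq_rem /= andbT.
apply/andP; split; apply/hasPn => i; last first.
  by move=> /mapP[w /remP[_ _ ltvw] ->]; rewrite !mem_iota; lia.
rewrite mem_cat mem_iota => /orP[ir|/mapP[w /remP[_ uw _] ->]].
  apply/mapP => -[x]; rewrite mem_nbr_seq // => vx ixE.
  have := labelling_adj fL vx; rewrite /cdist; lia.
apply/mapP => -[x]; rewrite mem_nbr_seq // => vx fwx.
exact: (edge_labels_neq acG h_gt0 fL uv uw vx) fwx.
Qed.

(** * Subtrees that force large spans *)

Lemma deg_contains (V : choiceType) (W : finType) (G : sgraph V) (H : sgraph W)
    (f : W -> V) (w : W) :
  finite_set (nbrs G (f w)) -> injective f ->
  (forall x y, adj H x y -> adj G (f x) (f y)) -> deg H w <= deg G (f w).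
Proof.
move=> finG injf fadj; rewrite -!size_nbr_seq -(size_map f).
apply: uniq_leq_size => [|_ /mapP[x wx ->]].
  by rewrite map_inj_uniq ?nbr_seq_uniq.
rewrite mem_nbr_seq //; apply: fadj; rewrite mem_nbr_seq in wx => //.
exact: finite_finset.
Qed.

Lemma span_ge_copied_high_degree_nbrs (V : choiceType) (W : finType) (G : sgraph V)
    (H : sgraph W) (h l D k : nat) (f : V -> nat) (r : W) (A : set W) :
  (forall u, finite_set (nbrs G u)) -> acyclic G -> 0 < h ->
  labelling h 1 1 G l f -> contains G H -> A #= `I_k -> 0 < k ->
  (forall w, A w -> adj H r w /\ D <= deg H w) ->
  h + (k - 1) + D <= l.
Proof.
move=> finG acG h_gt0 fL [g injg gadj] Ak k_gt0 AP.
have sizeS : size (map g (enum_fset (fset_set A))) = k.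
  by rewrite size_map; exact: card_fset_set.
rewrite -{1}sizeS; apply: (span_ge_high_degree_nbrs (u := g r) finG acG h_gt0 fL).
- by rewrite map_inj_uniq // fset_uniq.
- by rewrite sizeS.
move=> _ /mapP[w wA ->]; have Aw : A w.
  apply: set_mem; rewrite -in_fset_set //; exact: finite_finset.
have [rw Dw] := AP w Aw; split; first exact: gadj.
by apply: leq_trans Dw _; apply: deg_contains.
Qed.

Lemma dist_refl (V : Type) (G : sgraph V) (u : V) : dist G u u 0.
Proof. by split=> //; exists [::]. Qed.

(** Every vertex at level less than 2 is internal.  The witness is the set of
    children of the root: each has m children and, in addition, its parent. *)
Lemma complete_ary_high_degree_nbrs (m : nat) (W : finType) (H : sgraph W) :
  is_complete_ary m 2 H ->
  exists r A, A #= `I_m /\ forall w, A w -> adj H r w /\ m < deg H w.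
Proof.
move=> [_ [r [ary leaf]]].
have internal u n : n < 2 -> dist H r u n -> children H r u #= `I_m.
  move=> n_lt2 dn; apply: ary; apply/set0P/eqP => /leaf d2.
  by move: n_lt2; rewrite (is_min_unique dn d2).
exists r, (children H r r); split; first exact: internal (dist_refl H r).
move=> w [rw _]; split=> //.
have Cw : children H r w #= `I_m by apply: (internal w 1) => //; exact: dist_adj.
have finW (B : set W) : finite_set B := finite_finset.
rewrite -(card_fset_set Cw) -size_nbr_seq.
apply: (@uniq_leq_size _ (r :: enum_fset (fset_set (children H r w)))).
  rewrite /= fset_uniq andbT; apply/negP.
  rewrite -[_ \in _]/(r \in fset_set _) in_fset_set // => /set_mem[_ [n [_ drr]]].
  by have := is_min_unique drr (dist_refl H r).
move=> x; rewrite inE => /orP[/eqP->|]; rewrite mem_nbr_seq //.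
  by rewrite adj_sym.
by rewrite -[_ \in _]/(x \in fset_set _) in_fset_set // => /set_mem[].
Qed.

Lemma card_nbrs_full_copy (U : Type) (W : finType) (R : sgraph U) (H : sgraph W)
    (g : W -> U) (w : W) (d : nat) :
  injective g -> (forall x y, adj H x y = adj R (g x) (g y)) ->
  nbrs R (g w) `<=` range g -> nbrs R (g w) #= `I_d -> nbrs H w #= `I_d.
Proof.
move=> injg gadj sub; apply: card_eq_trans.
have <- : g @` nbrs H w = nbrs R (g w).
  apply/seteqP; split=> [_ [x wx <-]|y wy]; first by rewrite /nbrs /= -gadj.
  by have [x _ xE] := sub y wy; exists x => //; rewrite /nbrs /= gadj xE.
rewrite card_eq_sym; apply: inj_card_eq => x y _ _; exact: injg.
Qed.

(** The centre and its neighbours keep all their neighbours inside the ball of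
    radius 2, hence keep the full degree m + 1. *)
Lemma regular_ball_high_degree_nbrs (m : nat) (W : finType) (H : sgraph W) :
  is_regular_ball m 2 H ->
  exists r A, A #= `I_m.+1 /\ forall w, A w -> adj H r w /\ m < deg H w.
Proof.
move=> [U [R [c [g [[_ _ regR] injg rangeg gadj]]]]].
have ballP x n : n <= 2 -> walk R c x n -> range g x.
  move=> n_le2 wn; rewrite rangeg; have [k dk] := exists_is_min wn.
  by exists k => //; apply: leq_trans (dk.2 _ wn) _.
have [r _ rE] : range g c by apply: (ballP c 0) => //; exists [::].
have degP w : nbrs R (g w) `<=` range g -> nbrs H w #= `I_m.+1.
  by move=> sub; apply: card_nbrs_full_copy injg gadj sub (regR _).
exists r, (nbrs H r); split.
  apply: degP; rewrite rE => x cx; apply: (ballP x 1) => //.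
  by exists [:: x]; rewrite /= andbT; split.
move=> w rw; split=> //; rewrite /deg (@card_fset_set _ _ m.+1) //.
apply: degP => x wx.
apply: (ballP x 2) => //; exists [:: g w; x]; split=> //=.
by rewrite andbT -rE -gadj; apply/andP.
Qed.

(** * Rooting a tree *)

(** Otherwise a simple path extracted from p closes through u into a cycle of
    length at least 3. *)
Lemma adj_same_of_detour (V : eqType) (G : sgraph V) (u a b : V) (p : seq V) :
  acyclic G -> adj G u a -> adj G u b -> path (adj G) a p -> last a p = b ->
  u \notin a :: p -> a = b.
Proof.
move=> acG ua ub pathp lastp; move: lastp ub => <-.
case/shortenP: pathp => q pathq uniqq sub ub uNp.
have uNq : u \notin a :: q.
  by apply: contra uNp; rewrite !inE => /orP[->//|/sub->]; rewrite orbT.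
have /acG : ucycle (adj G) [:: u, a & q].
  apply/andP; split; last by rewrite cons_uniq uNq uniqq.
  by rewrite /= ua rcons_path pathq /= adj_sym ub.
by case: q {pathq uniqq sub ub uNq}.
Qed.

Lemma path_rev_sym (V : eqType) (G : sgraph V) (x : V) (p : seq V) :
  path (adj G) x p -> path (adj G) (last x p) (rev (belast x p)).
Proof.
rewrite rev_path; rewrite (@eq_path _ _ (adj G)) // => y z; exact: adj_sym.
Qed.

Lemma last_rev_belast (V : eqType) (x : V) (p : seq V) :
  last (last x p) (rev (belast x p)) = x.
Proof. by case: p => //= y p; rewrite rev_cons last_rcons. Qed.

Lemma walk_rcons (V : eqType) (G : sgraph V) (r u v : V) (n : nat) :
  walk G r u n -> adj G u v -> walk G r v n.+1.
Proof.
move=> [p [pathp lastp sizep]] uv; exists (rcons p v).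
by rewrite rcons_path pathp lastp uv last_rcons size_rcons sizep.
Qed.

Lemma geodesic_mem (V : eqType) (G : sgraph V) (dep : V -> nat) (r x : V)
    (p : seq V) :
  (forall v, dist G r v (dep v)) -> path (adj G) r p -> x \in r :: p ->
  x = last r p \/ dep x < size p.
Proof.
move=> depP pathp xp; case: (splitPl xp) pathp => p1 p2 lastp1.
rewrite cat_path => /andP[pathp1 _].
have le_x : dep x <= size p1 by apply: (depP x).2; exists p1.
case: p2 => [|y p2]; first by left; rewrite cats0.
by right; rewrite size_cat /=; lia.
Qed.

(** A geodesic from r to a neighbour of u not farther from r than u avoids u.  Two
    such geodesics, joined at r, would be a detour around u. *)
Lemma closer_nbr_unique (V : eqType) (G : sgraph V) (dep : V -> nat)
    (r u a b : V) :
  acyclic G -> (forall v, dist G r v (dep v)) ->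
  adj G u a -> adj G u b -> dep a <= dep u -> dep b <= dep u -> a = b.
Proof.
move=> acG depP ua ub au bu.
have avoid c p : adj G u c -> dep c <= dep u -> path (adj G) r p ->
    last r p = c -> size p = dep c -> u \notin r :: p.
  move=> uc cu pathp lastp sizep; apply/negP => /(geodesic_mem depP pathp)[uE|].
    by move: uc; rewrite -lastp -uE adj_irrefl.
  by rewrite sizep ltnNge cu.
have [[pa [patha lasta sizea]] _] := depP a.
have [[pb [pathb lastb sizeb]] _] := depP b.
have /avoid-/(_ pa) uNa := ua; have /avoid-/(_ pb) uNb := ub.
apply: (adj_same_of_detour (p := rev (belast r pa) ++ pb) acG ua ub).
- rewrite cat_path -{2}lasta last_rev_belast pathb andbT.
  by rewrite -lasta path_rev_sym.
- by rewrite last_cat -lasta last_rev_belast.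
rewrite -lasta -cat_cons mem_cat negb_or -rev_rcons -lastI mem_rev uNa //=.
by have := uNb bu pathb lastb sizeb; rewrite inE negb_or => /andP[].
Qed.

(** The form in which acyclicity is used: every edge joins a vertex to its
    parent.  An edge within a level, or from a vertex to a shallower one other
    than its parent, would give that vertex two neighbours not farther from r,
    against [closer_nbr_unique]. *)
Lemma tree_root (V : eqType) (G : sgraph V) :
  is_tree G ->
  exists (r : V) (par : V -> V) (dep : V -> nat),
    [/\ dep r = 0,
        forall v, v <> r -> adj G (par v) v /\ dep v = (dep (par v)).+1
      & forall u v, adj G u v ->
          (v <> r /\ par v = u) \/ (u <> r /\ par u = v)].
Proof.
move=> [[[r] conG] acG].
have /choice[dep depP] : forall v, exists n, dist G r v n.
  by move=> v; have [n wn] := conG r v; exact: exists_is_min wn.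
have dep_step u v : adj G u v -> dep v <= (dep u).+1.
  by move=> uv; apply: (depP v).2; apply: walk_rcons (depP u).1 uv.
have dep_r : dep r = 0 := is_min_unique (depP r) (dist_refl G r).
have dep_gt0 v : v <> r -> 0 < dep v.
  move=> v_neq_r; rewrite lt0n; apply/eqP => dep0; apply: v_neq_r.
  have [[p [_ lastp sizep]] _] := depP v; rewrite dep0 in sizep.
  by rewrite -lastp (size0nil sizep).
have /choice[par parP] : forall v, exists u, v <> r ->
    adj G u v /\ dep v = (dep u).+1.
  move=> v; have [[p [pathp lastp sizep]] _] := depP v.
  case/lastP: p pathp lastp sizep => [_ <- _|p w]; first by exists r.
  rewrite rcons_path last_rcons size_rcons => /andP[pathp uw] wv sizep.
  exists (last r p) => _; rewrite -wv; split=> //; apply/eqP.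
  rewrite eqn_leq dep_step // -wv in sizep *; rewrite -sizep ltnS.
  by apply: (depP _).2; exists p.
have parE u v : adj G u v -> dep u <= dep v -> v <> r /\ par v = u.
  move=> uv le_uv; have v_neq_r : v <> r.
    move=> vr; move: le_uv uv; rewrite vr dep_r leqn0 => /eqP dep_u0.
    have [<-|/eqP/dep_gt0] := eqVneq u r; first by rewrite adj_irrefl.
    by rewrite dep_u0.
  have [pv dep_v] := parP v v_neq_r; split=> //.
  by apply: (closer_nbr_unique (u := v) acG depP) => //; rewrite 1?adj_sym // dep_v.
exists r, par, dep; split=> // u v uv.
have [le_uv|/ltnW le_vu] := leqP (dep u) (dep v); first by left; exact: parE.
by right; apply: parE => //; rewrite adj_sym.
Qed.

(** * An elegant labelling of a rooted tree *)

Definition transpose (i j x : nat) : nat :=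
  if x == i then j else if x == j then i else x.

Lemma transpose_inj (i j : nat) : injective (transpose i j).
Proof. by move=> x y; rewrite /transpose; do !case: eqP => ?; lia. Qed.

(** The position of the label of w in the window of u.  The enumeration of N(u)
    is transposed so that p, the parent of u, falls on the position q that the
    label of p already occupies. *)
Definition slot (V : choiceType) (G : sgraph V) (u p : V) (q : nat) (w : V) : nat :=
  transpose (index p (nbr_seq G u)) q (index w (nbr_seq G u)).

(** The triple (s, o, q) attached to a vertex v at level n: its window starts at
    s, its label is s + o, and q is the position of the label of its parent
    relative to s.  All are lifts of residues modulo l; adding l to o keeps the
    subtraction of m exact.  At the root [par v] is a junk value, and the choice
    of q makes the transposition in [slot] trivial. *)
Fixpoint window (V : choiceType) (G : sgraph V) (par : V -> V) (D h l n : nat)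
    (v : V) : nat * nat * nat :=
  if n is n'.+1 then
    let: (s, o, q) := window G par D h l n' (par v) in
    let b := slot G (par v) (par (par v)) q v in
    let m := maxn D (b + h) in
    (s + m, b + l - m, o - m)
  else (0, D + h - 1, index (par v) (nbr_seq G v)).

(** Here s gives the starts of the windows, o the offsets of labels from these
    starts, and b u w the position of the label of w in the window of u.  A shift
    m between D and l - D makes two windows of length D disjoint modulo l. *)
Definition layout (V : Type) (G : sgraph V) (D h l : nat) (s o : V -> nat)
    (b : V -> V -> nat) : Prop :=
  [/\ forall u w, adj G u w -> b u w < D,
      forall u w w', adj G u w -> adj G u w' -> b u w = b u w' -> w = w',
      forall u, D + h - 1 <= o u <= l - h,
      forall u w, adj G u w -> s u + b u w = s w + o w %[mod l]
    & forall u w, adj G u w -> exists2 m, D <= m <= l - D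
        & s w = s u + m \/ s u = s w + m].

(** The invariant D + h - 1 <= o <= l - h says that the label of a vertex is at
    distance at least h from its window.  It passes to the child at position b
    because b + l - m lies in the same range, and the position o - m of the
    parent is in [0, D) by the value of l. *)
Lemma exists_layout (V : choiceType) (G : sgraph V) (D h l : nat) :
  is_tree G -> (forall u, finite_set (nbrs G u)) ->
  (forall u, deg G u <= D) -> 0 < D -> 0 < h ->
  l = maxn (h + 2 * D - 1) (2 * h + D - 1) ->
  exists s o b, layout G D h l s o b.
Proof.
move=> treeG finG degD D_gt0 h_gt0 lE.
have [r [par [dep [dep_r parP adjP]]]] := tree_root treeG.
pose st v := window G par D h l (dep v) v.
pose s v := (st v).1.1; pose o v := (st v).1.2; pose q v := (st v).2.
pose b u w := slot G u (par u) (q u) w.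
pose m v := maxn D (b (par v) v + h).
have st_par v : v <> r ->
    [/\ s v = s (par v) + m v, o v = b (par v) v + l - m v & q v = o (par v) - m v].
  move=> /parP[_ depv]; rewrite /s /o /q /m /b /q /st depv /=.
  by case: (window _ _ _ _ _ _ (par v)) => [[]].
have slot_ltD u w : adj G u w -> q u < D \/ u = r -> b u w < D.
  have ltD v : adj G u v -> index v (nbr_seq G u) < D.
    by move=> uv; apply: leq_trans (degD u); rewrite index_mem mem_nbr_seq.
  move=> uw qu; have := ltD w uw.
  rewrite /b /slot; have [u_r|/eqP u_neq_r] := eqVneq u r.
    have -> : q u = index (par u) (nbr_seq G u) by rewrite /q /st u_r dep_r.
    by rewrite /transpose; case: eqP => [<-|_] //; case: eqP => // ->.
  case: qu => // qu wD; have pD : index (par u) (nbr_seq G u) < D.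
    by apply: ltD; rewrite adj_sym; case: (parP u u_neq_r).
  by rewrite /transpose; case: eqP => // _; case: eqP.
have inv v : (D + h - 1 <= o v <= l - h) /\ (q v < D \/ v = r).
  have [n] := ubnP (dep v); elim: n v => // n IH v; rewrite ltnS => dep_le.
  have [->|/eqP v_neq_r] := eqVneq v r.
    by rewrite /o /st dep_r /=; split; [lia|right].
  have [pv depv] := parP v v_neq_r; have [op qp] := IH (par v) ltac:(lia).
  have bD := slot_ltD _ _ pv qp; have [_ -> ->] := st_par v v_neq_r.
  by rewrite /m; split; [lia|left; lia].
have bD u w : adj G u w -> b u w < D.
  by move=> uw; apply: slot_ltD uw (inv u).2.
exists s, o, b; split=> //.
- move=> u w w' uw uw' /transpose_inj; apply: (index_inj u); rewrite mem_nbr_seq //.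
- by move=> u; exact: (inv u).1.
- move=> u w uw; have [[w_neq_r puE]|[u_neq_r puE]] := adjP u w uw.
    have [-> -> _] := st_par w w_neq_r; rewrite puE.
    have := bD u w uw; rewrite /m puE => bDuw.
    (* The offset of the child was lifted by l. *)
    by rewrite -[LHS](modnDr _ l); congr (_ %% _); lia.
  have [-> _ qu] := st_par u u_neq_r; rewrite puE.
  have -> : b u w = q u by rewrite /b /slot puE /transpose eqxx.
  have wu : adj G w u by rewrite adj_sym.
  have := bD w u wu; have [ow _] := inv w; rewrite qu puE /m puE => bDwu.
  by congr (_ %% _); lia.
move=> u w uw; have [[w_neq_r puE]|[u_neq_r puE]] := adjP u w uw.
  have := bD u w uw => bDuw; exists (m w); first by rewrite /m puE; lia.
  by left; have [-> _ _] := st_par w w_neq_r; rewrite puE.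
have := bD w u; rewrite adj_sym => /(_ uw) bDwu.
exists (m u); first by rewrite /m puE; lia.
by right; have [-> _ _] := st_par u u_neq_r; rewrite puE.
Qed.

(** A layout is a labelling on any graph: ends of an edge are separated by the
    offset condition, vertices at distance 2 by distinct positions in one window,
    vertices at distance 3 by disjointness of adjacent windows. *)
Lemma layout_labelling (V : eqType) (G : sgraph V) (D h l : nat)
    (s o : V -> nat) (b : V -> V -> nat) :
  0 < D -> 0 < h -> 2 * h + D - 1 <= l -> 2 * D <= l ->
  layout G D h l s o b ->
  exists f, labelling h 1 1 G l f /\ elegant G l f.
Proof.
move=> D_gt0 h_gt0 hD2l D2l [bD binj oP sb sep]; have l_gt0 : 0 < l by lia.
pose f v := (s v + o v) %% l.
have fl v : f v < l by exact: ltn_pmod.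
have fE u w : adj G u w -> f w = (s u + b u w) %% l by move=> /sb.
have sepE u w i j : adj G u w -> i < D -> j < D ->
    (s u + i) %% l <> (s w + j) %% l.
  move=> uw iD jD; have [k kP [sE|sE]] := sep u w uw; rewrite sE.
    have -> : s u + k + j = s u + i + (k + j - i) by lia.
    by apply/(@cdist_gt0_neq l)/cdist_mod_ge; lia.
  have -> : s w + k + i = s w + j + (k + i - j) by lia.
  by apply/(@cdist_gt0_neq l); rewrite cdistC; apply: cdist_mod_ge; lia.
exists f; split.
  split=> //.
  - move=> u v [[[|w [|? ?]] [] //= + wv _] _]; rewrite wv andbT => uv.
    rewrite (fE u v uv) /f; have := oP u; have := bD u v uv => bDuv oPu.
    have -> : s u + o u = s u + b u v + (o u - b u v) by lia.
    by rewrite cdistC; apply: cdist_mod_ge; lia.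
  - move=> u v [[[|x [|y [|? ?]]] [] //= + yv _] min2].
    rewrite yv andbT => /andP[ux xv]; apply: cdist_gt0 => //.
    have xu : adj G x u by rewrite adj_sym.
    rewrite (fE x u xu) (fE x v xv) => fuv.
    have buv : b x u = b x v.
      apply: contrapT => buv.
      have [lt|le] := ltnP (b x u) (b x v).
        have := @cdist_mod_ge l 1 (b x v - b x u) (s x + b x u).
        have := bD x v xv => bxv; rewrite fuv.
        have -> : s x + b x u + (b x v - b x u) = s x + b x v by lia.
        by move=> /(_ ltac:(lia) ltac:(lia)) /cdist_gt0_neq.
      have := @cdist_mod_ge l 1 (b x u - b x v) (s x + b x v).
      have := bD x u xu => bxu; rewrite -fuv.
      have -> : s x + b x v + (b x u - b x v) = s x + b x u by lia.
      by move=> /(_ ltac:(lia) ltac:(lia)) /cdist_gt0_neq.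
    have uv := binj x u v xu xv buv.
    by have /min2 : walk G u v 0 by exists [::]; rewrite uv.
  move=> u v [[[|x [|y [|z [|? ?]]]] [] //= + zv _] _].
  rewrite zv andbT => /and3P[ux xy yv]; apply: cdist_gt0 => //.
  have xu : adj G x u by rewrite adj_sym.
  rewrite (fE x u xu) (fE y v yv); apply: sepE => //; exact: bD.
exists (fun u => [set i %% l | i in [set i | s u <= i <= s u + (D - 1)]]); split.
- by move=> u; exists (s u), (s u + (D - 1)); split=> //; lia.
- move=> u _ [w uw <-]; exists (s u + b u w); last by rewrite (fE u w uw).
  by have := bD u w uw; rewrite /=; lia.
move=> u w uw; apply/seteqP; split=> // _ [[i /= iP <-] [j /= jP]].
have := sepE u w (i - s u) (j - s w) uw ltac:(lia) ltac:(lia).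
by rewrite !subnKC; [move=> neq /esym/neq|lia|lia].
Qed.

(** * Spans of trees *)

Theorem theorem5p3 (V : countType) (T : sgraph V) (Delta Delta2 h : nat)
    (treeT : is_tree T)
    (sizeT : (finite_set [set: V] /\ exists2 D, diameter T D & 3 <= D)
             \/ infinite_set [set: V])
    (DeltaT : max_degree T Delta) (Delta_ge3 : 3 <= Delta)
    (Delta2T : max_edge_degree T Delta2)
    (h_ge1 : 1 <= h) :
  exists s s' : nat,
    [/\ is_sigma h 1 1 T s,
        is_sigma_star h 1 1 T s',
        [/\ maxn Delta2 (2 * h + Delta - 1) <= s,
            s <= s'
          & s' <= maxn (h + 2 * Delta - 1) (2 * h + Delta - 1)],
        h <= Delta ->
        (exists (W : finType) (H : sgraph W),
           is_complete_ary (Delta - 1) 2 H /\ contains T H) ->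
        [/\ h + 2 * Delta - 2 <= s, s <= s' & s' <= h + 2 * Delta - 1]
      & h <= Delta ->
        (exists (W : finType) (H : sgraph W),
           is_regular_ball (Delta - 1) 2 H /\ contains T H) ->
        s = s' /\ s' = h + 2 * Delta - 1].
Proof.
have [finT [[u0 _ deg_u0] deg_max]] := DeltaT.
have degD u : deg T u <= Delta by apply: deg_max; exists u.
have [_ acT] := treeT.
set l := maxn (h + 2 * Delta - 1) (2 * h + Delta - 1).
have [sw [o [b lay]]] : exists s o b, layout T Delta h l s o b.
  by apply: exists_layout => //; lia.
have [f fP] : exists f, labelling h 1 1 T l f /\ elegant T l f.
  by apply: layout_labelling lay; lia.
have [s' s'P] : exists s', is_sigma_star h 1 1 T s'.
  by apply: (@exists_is_min _ l); exists f.
have [s sP] : exists s, is_sigma h 1 1 T s.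
  by apply: (@exists_is_min _ l); exists f; case: fP.
have s_le_s' : s <= s' by have [[g [gL _]] _] := s'P; apply: sP.2; exists g.
have s'_le : s' <= l by apply: s'P.2; exists f.
have [[g gL] _] := sP.
exists s, s'; split=> //.
- split=> //; have [[u [v [uv ->]]] _] := Delta2T.
  rewrite geq_max (span_ge_edge_degree finT acT h_ge1 gL uv) /= -deg_u0.
  have [v0 u0v0] : exists v0, adj T u0 v0.
    have : 0 < size (nbr_seq T u0) by rewrite size_nbr_seq deg_u0; lia.
    case nbrE: (nbr_seq T u0) => [//|v0 t] _; exists v0.
    by rewrite -mem_nbr_seq // nbrE mem_head.
  exact: span_ge_star gL u0v0.
- move=> hD [W [H [aryH TH]]].
  have [r [A [cardA AP]]] := complete_ary_high_degree_nbrs aryH.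
  have := span_ge_copied_high_degree_nbrs finT acT h_ge1 gL TH cardA ltac:(lia) AP.
  by split=> //; lia.
move=> hD [W [H [ballH TH]]].
have [r [A [cardA AP]]] := regular_ball_high_degree_nbrs ballH.
have := span_ge_copied_high_degree_nbrs finT acT h_ge1 gL TH cardA ltac:(lia) AP.
by split; lia.
Qed.
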